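(* Let $G$ be a group satisfying the property $\mathsf{FM}$ and let $\nu$ be a conjugation-invariant pseudo-norm on $G$. Then: (1) For any element $g\in G$ with $s\nu(g)>0$, there exists a function $\phi\colon G\to\mathbb{R}$ which is a homogeneous $H$-quasimorphism for every $H\in\mathsf{FM}(G)$ and satisfies $\phi(g)>0$. (2) For any element $g$ of the commutator subgroup $[G,G]$ and any $H\in\mathsf{FM}(G)$, \[ s\nu(g)\leq 8\sup_\phi\frac{\phi(g)\cdot E_{H,\nu}(H)}{D(\phi)}, \] where the supremum is taken over the set of homogeneous $H$-quasimorphisms $\phi\colon G\to\mathbb{R}$.
   Context: A conjugation-invariant pseudo-norm on a group $G$ is a function $\nu\colon G\to\mathbb{R}_{\ge0}$ with $\nu(1)=0$, $\nu(f)=\nu(f^{-1})$, $\nu(fg)\le\nu(f)+\nu(g)$ and $\nu(gfg^{-1})=\nu(f)$ for all $f,g\in G$. Its stabilization is $s\nu(g)=\lim_{n\to\infty}\nu(g^n)/n$. For a subgroup $H\le G$, the fragmentation norm $\nu_H(f)$ is the minimal $k$ such that $f=g_1h_1g_1^{-1}\cdots g_kh_kg_k^{-1}$ with $g_i\in G$, $h_i\in H$ ($\nu_H(f)=\infty$ if no such decomposition exists). $G$ is c-generated by $H$ if $\nu_H(g)<\infty$ for all $g\in G$. A function $\phi\colon G\to\mathbb{R}$ is an $H$-quasimorphism if there is $C>0$ with $|\phi(fg)-\phi(f)-\phi(g)|<C\min\{\nu_H(f),\nu_H(g)\}$ for all $f,g\in G$; the infimum of such $C$ is the defect $D(\phi)$.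 It is homogeneous if $\phi(f^n)=n\phi(f)$ for all $f\in G$, $n\in\mathbb{Z}$. For a subset $K\subset G$ and $a,b\in G$, $aKb=\{akb:k\in K\}$. Define $\mathrm{D}^f_H(K)$ as the set of $h_0\in G$ such that for all $g_1,\dots,g_k\in G$ there is $h\in G$ such that every element of $hh_0h^{-1}K(hh_0h^{-1})^{-1}$ commutes with every element of $g_1Hg_1^{-1}\cup\dots\cup g_kHg_k^{-1}$. The far away displacement energy is $E_{H,\nu}(K)=\inf_{h_0\in\mathrm{D}^f_H(K)}\nu(h_0)$. $(G,H)$ satisfies property $\mathsf{FM}$ if $G$ is c-generated by $H$ and $\mathrm{D}^f_H(h_1Hh_1^{-1}\cup\dots\cup h_kHh_k^{-1})\ne\emptyset$ for all $h_1,\dots,h_k\in G$. $G$ satisfies $\mathsf{FM}$ if $(G,H)$ does for some subgroup $H$; $\mathsf{FM}(G)$ is the set of all such subgroups $H$.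
   Formalization: The strict ''<'' in the definition of H-quasimorphism, which fails at f=1 because ν_H(1)=0, is read as ''≤''; in the supremum, terms with D(φ)=0 (homomorphisms, where the quotient is 0/0 on [G,G]) are given the value 0. *)

(* Defs.v *)
From Stdlib Require Import Reals List.
From Coquelicot Require Import Coquelicot.
Open Scope R_scope.

Record Group := {
  carrier :> Type;
  gmul : carrier -> carrier -> carrier;
  gone : carrier;
  ginv : carrier -> carrier;
  gmul_assoc : forall x y z, gmul x (gmul y z) = gmul (gmul x y) z;
  gmul_1l : forall x, gmul gone x = x;
  gmul_1r : forall x, gmul x gone = x;
  gmul_Vl : forall x, gmul (ginv x) x = gone;
  gmul_Vr : forall x, gmul x (ginv x) = gone
}.

Arguments gmul {_} _ _.
Arguments gone {_}.
Arguments ginv {_} _.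

Section GroupDefs.
Variable G : Group.

Fixpoint gpow (x : G) (n : nat) : G :=
  match n with O => gone | S n => gmul x (gpow x n) end.

Definition gpowZ (x : G) (z : Z) : G :=
  match z with
  | Z0 => gone
  | Zpos p => gpow x (Pos.to_nat p)
  | Zneg p => ginv (gpow x (Pos.to_nat p))
  end.

Definition conj (g x : G) : G := gmul (gmul g x) (ginv g).

Definition commutes (x y : G) : Prop := gmul x y = gmul y x.

Definition is_subgroup (H : G -> Prop) : Prop :=
  H gone /\ (forall x y, H x -> H y -> H (gmul x y)) /\ (forall x, H x -> H (ginv x)).

Definition is_cinv_pseudo_norm (nu : G -> R) : Prop :=
  (forall f, 0 <= nu f) /\ nu gone = 0 /\
  (forall f, nu f = nu (ginv f)) /\
  (forall f g, nu (gmul f g) <= nu f + nu g) /\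
  (forall f g, nu (conj g f) = nu f).

Definition stab (nu : G -> R) (g : G) : R :=
  real (Lim_seq (fun n => nu (gpow g n) / INR n)).

Fixpoint prod_conj (l : list (G * G)) : G :=
  match l with
  | nil => gone
  | (g, h) :: l' => gmul (conj g h) (prod_conj l')
  end.

Definition frag_le (H : G -> Prop) (f : G) (k : nat) : Prop :=
  exists l : list (G * G), length l = k /\ (forall p, In p l -> H (snd p)) /\
    f = prod_conj l.

(* fragmentation norm nu_H(f) : the minimal such k, +oo if none exists *)
Definition frag_norm (H : G -> Prop) (f : G) : Rbar :=
  Glb_Rbar (fun x => exists k, frag_le H f k /\ x = INR k).

Definition c_generated (H : G -> Prop) : Prop :=
  forall g : G, exists k, frag_le H g k.

Definition qm_bound (H : G -> Prop) (phi : G -> R) (C : R) : Prop :=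
  forall f g : G,
    Rbar_le (Finite (Rabs (phi (gmul f g) - phi f - phi g)))
            (Rbar_mult (Finite C) (Rbar_min (frag_norm H f) (frag_norm H g))).

Definition H_quasimorphism (H : G -> Prop) (phi : G -> R) : Prop :=
  exists C, 0 < C /\ qm_bound H phi C.

Definition defect (H : G -> Prop) (phi : G -> R) : R :=
  real (Glb_Rbar (fun C => 0 < C /\ qm_bound H phi C)).

Definition homogeneous (phi : G -> R) : Prop :=
  forall (f : G) (n : Z), phi (gpowZ f n) = IZR n * phi f.

Definition far_disp (H : G -> Prop) (K : G -> Prop) (h0 : G) : Prop :=
  forall gs : list G, exists h : G,
    forall k x : G, K k ->
      (exists gi a, In gi gs /\ H a /\ x = conj gi a) ->
      commutes (conj (conj h h0) k) x.

Definition far_energy (H : G -> Prop) (nu : G -> R) (K : G -> Prop) : R :=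
  real (Glb_Rbar (fun e => exists h0, far_disp H K h0 /\ e = nu h0)).

Definition union_conjs (H : G -> Prop) (hs : list G) (x : G) : Prop :=
  exists hi a, In hi hs /\ H a /\ x = conj hi a.

Definition FM_pair (H : G -> Prop) : Prop :=
  is_subgroup H /\ c_generated H /\
  (forall hs : list G, exists h0, far_disp H (union_conjs H hs) h0).

Definition satisfies_FM : Prop := exists H, FM_pair H.

Definition commutator (a b : G) : G := gmul (gmul a b) (gmul (ginv a) (ginv b)).

Definition in_commutator_subgroup (g : G) : Prop :=
  exists l : list (G * G),
    g = fold_right (fun p acc => gmul (commutator (fst p) (snd p)) acc) gone l.

End GroupDefs.

Arguments stab {G} _ _.
Arguments frag_norm {G} _ _.
Arguments H_quasimorphism {G} _ _.
Arguments defect {G} _ _.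
Arguments homogeneous {G} _.
Arguments far_energy {G} _ _ _.
Arguments FM_pair {G} _.
Arguments is_cinv_pseudo_norm {G} _.
Arguments in_commutator_subgroup {G} _.

(* Main.v *)
(* A list [x1, ..., xm] of elements of [G] stands for the formal sum
   [x1 + ... + xm], and its size is the rate at which [nu (x1^n ... xm^n)] grows
   with [n].  By FM any [b] has a conjugate [k b k^-1] commuting with a given
   [a], and the distance between [b^n] and [k b^n k^-1] is at most [2 nu k]
   whatever [n] is; so the order of the factors is irrelevant and the growth rate
   is a sublinear functional on the free abelian group on [G].  A Hahn-Banach
   argument gives an additive functional below it which is at least [stab nu g]
   on [g]; its restriction [phi] to [G] is homogeneous.  If [b] is conjugate into
   [H] and the conjugate of [b] by [k] commutes with [f], then [(f b)^n] and
   [f^n b^n] are at distance at most [2 n nu k + 2 nu k], so [phi] is additive up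
   to [2 nu k] on such pairs.  Hence [phi] has defect at most [4 E(H)], which
   proves both parts, even with [4] in place of [8]. *)
Require Import Defs.
From Stdlib Require Import Reals List Permutation Lra Lia Classical.
From Coquelicot Require Import Coquelicot.
From mathcomp Require Import ssreflect.
From mathcomp Require boolp classical_sets.
Open Scope general_if_scope.
Open Scope R_scope.

(** * Infima of bounded sets of reals *)

Definition Inf (S : R -> Prop) : R := real (Glb_Rbar S).

(** A member of [S] excludes [p_infty] and a lower bound excludes [m_infty], so the default value of
    [real] never enters. *)
Lemma Glb_Rbar_Inf (S : R -> Prop) (m s0 : R) :
  S s0 -> (forall s, S s -> m <= s) -> Glb_Rbar S = Finite (Inf S).
Proof.
  intros H0 Hm. unfold Inf.
  destruct (Glb_Rbar_correct S) as [Hlb Hglb].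
  assert (H1 := Hglb (Finite m) (fun s Hs => Hm s Hs)).
  assert (H2 := Hlb s0 H0).
  now destruct (Glb_Rbar S).
Qed.

Lemma Inf_glb (S : R -> Prop) (m s0 : R) :
  S s0 -> (forall s, S s -> m <= s) ->
  (forall s, S s -> Inf S <= s) /\
  (forall b, (forall s, S s -> b <= s) -> b <= Inf S).
Proof.
  intros H0 Hm. destruct (Glb_Rbar_correct S) as [Hlb Hglb].
  rewrite (Glb_Rbar_Inf S m s0 H0 Hm) in Hlb Hglb.
  split; [exact Hlb|]. intros b Hb. exact (Hglb (Finite b) Hb).
Qed.

(** * Sublinear functionals on formal sums and a Hahn-Banach theorem *)

Section SublinearFunctionals.
Variables (A : Type) (inv : A -> A).

Definition opp (x : list A) : list A := map inv x.
Definition rep (m : nat) (x : list A) : list A := concat (repeat x m).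

Lemma rep_nil (m : nat) : rep m nil = nil.
Proof. induction m as [|m IH]; [reflexivity|exact IH]. Qed.

Lemma rep_add (m n : nat) (x : list A) : rep (m + n) x = rep m x ++ rep n x.
Proof. unfold rep. now rewrite repeat_app concat_app. Qed.

Lemma rep_app (m : nat) (x y : list A) :
  Permutation (rep m (x ++ y)) (rep m x ++ rep m y).
Proof.
  induction m as [|m IH]; [apply Permutation_refl|].
  cbn. fold (rep m (x ++ y)) (rep m x) (rep m y).
  rewrite IH -!app_assoc. apply Permutation_app_head.
  apply Permutation_app_swap_app.
Qed.

Lemma rep_opp (m : nat) (x : list A) : rep m (opp x) = opp (rep m x).
Proof.
  induction m as [|m IH]; [reflexivity|].
  cbn. fold (rep m (opp x)) (rep m x).
  rewrite IH. unfold opp. now rewrite map_app.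
Qed.

Lemma rep_perm (m : nat) (x y : list A) :
  Permutation x y -> Permutation (rep m x) (rep m y).
Proof.
  intros H. induction m as [|m IH]; [apply Permutation_refl|].
  now apply Permutation_app.
Qed.

(* Sublinear functionals on the free abelian group on [A] modulo [inv a = - a],
   whose elements are represented by lists.  Positive homogeneity is not
   required: it holds automatically for minimal functionals. *)
Record sublin (q : list A -> R) : Prop := {
  sublin_add : forall x y, q (x ++ y) <= q x + q y;
  sublin_perm : forall x y, Permutation x y -> q x = q y;
  sublin_cancel : forall z x, q (z ++ opp z ++ x) = q x;
  sublin_nil : q nil = 0
}.

(** Serves as a lower bound that keeps infima over chains of functionals finite. *)
Lemma sublin_opp_ge (q : list A -> R) (x : list A) :
  sublin q -> - q (opp x) <= q x.
Proof.
  intros Hq.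
  assert (H := sublin_add q Hq x (opp x ++ nil)).
  rewrite (sublin_cancel q Hq) (sublin_nil q Hq) app_nil_r in H. lra.
Qed.

Lemma sublin_rep_le (q : list A -> R) (m : nat) (x : list A) :
  sublin q -> q (rep m x) <= INR m * q x.
Proof.
  intros Hq. induction m as [|m IH].
  - cbn. rewrite (sublin_nil q Hq). lra.
  - rewrite S_INR.
    assert (H := sublin_add q Hq x (rep m x)).
    change (rep (S m) x) with (x ++ rep m x). lra.
Qed.

(** By [sublin_rep_le] the rescaled functional lies below [q], so a minimal [q] equals it; this is
    the source of homogeneity. *)
Lemma sublin_rescale (q : list A -> R) (m : nat) :
  sublin q -> (0 < m)%nat -> sublin (fun x => q (rep m x) / INR m).
Proof.
  intros Hq Hm. apply lt_INR in Hm. simpl in Hm. split.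
  - intros x y. rewrite (sublin_perm q Hq _ _ (rep_app m x y)).
    assert (H := sublin_add q Hq (rep m x) (rep m y)).
    unfold Rdiv. rewrite -Rmult_plus_distr_r. apply Rmult_le_compat_r; [|lra].
    apply Rlt_le, Rinv_0_lt_compat, Hm.
  - intros x y H. now rewrite (sublin_perm q Hq _ _ (rep_perm m x y H)).
  - intros z x. rewrite (sublin_perm q Hq _ (rep m z ++ opp (rep m z) ++ rep m x)).
    + now rewrite (sublin_cancel q Hq).
    + rewrite rep_app -rep_opp. apply Permutation_app_head, rep_app.
  - rewrite rep_nil (sublin_nil q Hq). lra.
Qed.

(* The largest sublinear functional below [q] whose value at [- y] is at most
   [- q y]. *)
Definition push (q : list A -> R) (y x : list A) : R :=
  Inf (fun r => exists t, r = q (x ++ rep t y) - INR t * q y).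

Section Push.
Variables (q : list A -> R) (y : list A).
Hypotheses (Hq : sublin q) (Hy : forall t, INR t * q y <= q (rep t y)).

(** Subadditivity and [Hy] give [q (x + t y) >= q (t y) - q (- x) >= t q y - q (- x)], so the
    infimum is finite. *)
Lemma push_glb (x : list A) :
  (forall t, push q y x <= q (x ++ rep t y) - INR t * q y) /\
  (forall b, (forall t, b <= q (x ++ rep t y) - INR t * q y) -> b <= push q y x).
Proof.
  destruct (Inf_glb (fun r => exists t, r = q (x ++ rep t y) - INR t * q y)
              (- q (opp x)) (q (x ++ rep 0 y) - INR 0 * q y)) as [H1 H2].
  - now exists O.
  - intros s [t ->].
    assert (H := sublin_add q Hq (x ++ rep t y) (opp x)).
    rewrite (sublin_perm q Hq _ (x ++ opp x ++ rep t y)) in H.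
    + rewrite (sublin_cancel q Hq) in H. specialize (Hy t). lra.
    + rewrite -app_assoc. apply Permutation_app_head, Permutation_app_comm.
  - split.
    + intros t. apply H1. now exists t.
    + intros b Hb. apply H2. intros s [t ->]. apply Hb.
Qed.

Lemma push_le (x : list A) : push q y x <= q x.
Proof.
  assert (H := proj1 (push_glb x) O). cbn in H. rewrite app_nil_r in H. lra.
Qed.

Lemma push_opp : push q y (opp y) <= - q y.
Proof.
  (* The term [t = 1] of the infimum is [q 0 - q y]. *)
  assert (H := proj1 (push_glb (opp y)) 1%nat).
  rewrite (sublin_perm q Hq _ (y ++ opp y ++ nil)) in H.
  - rewrite (sublin_cancel q Hq) (sublin_nil q Hq) in H. simpl in H. lra.
  - cbn. rewrite !app_nil_r. apply Permutation_app_comm.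
Qed.

Lemma push_sublin : sublin (push q y).
Proof.
  split.
  - intros x z.
    (* Indices [t] for [x] and [s] for [z] combine to the index [t + s] for the sum; the infima over
       [s] and [t] are then taken separately. *)
    assert (Hxz : forall t s, push q y (x ++ z) - (q (z ++ rep s y) - INR s * q y)
                  <= q (x ++ rep t y) - INR t * q y).
    { intros t s. assert (H := proj1 (push_glb (x ++ z)) (t + s)%nat).
      rewrite plus_INR in H.
      rewrite (sublin_perm q Hq _ ((x ++ rep t y) ++ (z ++ rep s y))) in H.
      - assert (H' := sublin_add q Hq (x ++ rep t y) (z ++ rep s y)). lra.
      - rewrite rep_add -!app_assoc. apply Permutation_app_head.
        apply Permutation_app_swap_app. }
    cut (push q y (x ++ z) - push q y x <= push q y z); [lra|].
    apply (proj2 (push_glb z)). intros s.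
    cut (push q y (x ++ z) - (q (z ++ rep s y) - INR s * q y) <= push q y x); [lra|].
    apply (proj2 (push_glb x)). intros t. apply Hxz.
  - cut (forall x z, Permutation x z -> push q y x <= push q y z).
    { intros H x z Hxz. apply Rle_antisym; apply H; [|symmetry]; exact Hxz. }
    intros x z Hxz. apply (proj2 (push_glb z)). intros t.
    rewrite -(sublin_perm q Hq _ _ (Permutation_app_tail (rep t y) Hxz)).
    apply (proj1 (push_glb x)).
  - intros z x. apply Rle_antisym.
    + apply (proj2 (push_glb x)). intros t.
      assert (H := proj1 (push_glb (z ++ opp z ++ x)) t).
      rewrite -!app_assoc (sublin_cancel q Hq) in H. exact H.
    + apply (proj2 (push_glb _)). intros t.
      rewrite -!app_assoc (sublin_cancel q Hq). apply (proj1 (push_glb _)).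
  - apply Rle_antisym.
    + rewrite -(sublin_nil q Hq). apply push_le.
    + apply (proj2 (push_glb nil)). intros t. specialize (Hy t). cbn. lra.
Qed.
End Push.

(** Zorn's lemma, with the pointwise infimum as bound of a nonempty chain. *)
Lemma sublin_minimal (p : list A -> R) : sublin p ->
  exists q, sublin q /\ (forall x, q x <= p x) /\
    forall q', sublin q' -> (forall x, q' x <= q x) -> forall x, q' x = q x.
Proof.
  intros Hp.
  set (T := {q : list A -> R | sublin q /\ forall x, q x <= p x}).
  (* Larger for [below] means pointwise smaller, so a maximal element is a minimal functional. *)
  set (below := fun s t : T => forall x, proj1_sig t x <= proj1_sig s x).
  destruct (@classical_sets.ZL_preorder T
    (exist _ p (Logic.conj Hp (fun x => Rle_refl (p x))))
    (fun s t => boolp.asbool (below s t))) as [[q [Hq Hqp]] Hmin].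
  - intros t. apply boolp.asboolT. intros x. apply Rle_refl.
  - intros r s t Hrs Hst. apply boolp.asboolT. intros x.
    apply boolp.asboolW in Hrs, Hst. eapply Rle_trans; [apply Hst|apply Hrs].
  - intros F HF.
    destruct (classic (exists s, F s)) as [[s0 Hs0]|Hempty].
    2:{ exists (exist _ p (Logic.conj Hp (fun x => Rle_refl (p x)))).
        intros s Hs. destruct Hempty. now exists s. }
    set (E := fun x r => exists s, F s /\ r = proj1_sig s x).
    assert (HE : forall x, (forall s, F s -> Inf (E x) <= proj1_sig s x) /\
      (forall b, (forall s, F s -> b <= proj1_sig s x) -> b <= Inf (E x))).
    { intros x.
      destruct (Inf_glb (E x) (- p (opp x)) (proj1_sig s0 x)) as [H1 H2].
      - now exists s0.
      - intros r [s [_ ->]]. destruct s as [q [Hq Hqp]]. simpl.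
        assert (H := sublin_opp_ge q x Hq). specialize (Hqp (opp x)). lra.
      - split.
        + intros s Hs. apply H1. now exists s.
        + intros b Hb. apply H2. intros r [s [Hs ->]]. now apply Hb. }
    assert (Heq : forall x y, (forall s, F s -> proj1_sig s x = proj1_sig s y) ->
              Inf (E x) = Inf (E y)).
    { intros x y H. apply Rle_antisym; apply HE; intros s Hs;
        [rewrite -H //|rewrite H //]; now apply HE. }
    assert (Hinf : sublin (fun x => Inf (E x)) /\ forall x, Inf (E x) <= p x).
    { repeat split.
      - intros x y.
        (* Here the chain condition enters: subadditivity of the smaller of [s] and [t] gives the
           mixed bound. *)
        assert (Hst : forall s t, F s -> F t ->
                  Inf (E (x ++ y)) <= proj1_sig s x + proj1_sig t y).
        { intros s t Hs Ht.
          destruct (HF s t Hs Ht) as [H|H]; apply boolp.asboolW in H;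
            [assert (H' := sublin_add _ (proj1 (proj2_sig t)) x y);
             assert (HI := proj1 (HE (x ++ y)) t Ht); specialize (H x)
            |assert (H' := sublin_add _ (proj1 (proj2_sig s)) x y);
             assert (HI := proj1 (HE (x ++ y)) s Hs); specialize (H y)]; lra. }
        cut (Inf (E (x ++ y)) - Inf (E x) <= Inf (E y)); [lra|].
        apply HE. intros t Ht.
        cut (Inf (E (x ++ y)) - proj1_sig t y <= Inf (E x)); [lra|].
        apply HE. intros s Hs. specialize (Hst s t Hs Ht). lra.
      - intros x y H. apply Heq. intros s _.
        now apply (sublin_perm _ (proj1 (proj2_sig s))).
      - intros z x. apply Heq. intros s _.
        apply (sublin_cancel _ (proj1 (proj2_sig s))).
      - apply Rle_antisym.
        + rewrite -(sublin_nil _ (proj1 (proj2_sig s0))). now apply HE.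
        + apply HE. intros s _. rewrite (sublin_nil _ (proj1 (proj2_sig s))). lra.
      - intros x. eapply Rle_trans; [apply (proj1 (HE x) _ Hs0)|].
        apply (proj2 (proj2_sig s0)). }
    exists (exist _ (fun x => Inf (E x)) Hinf : T). intros s Hs.
    apply boolp.asboolT. intros x. simpl.
    now apply HE.
  - exists q. split; [exact Hq|split; [exact Hqp|]]. intros q' Hq' Hle x.
    apply Rle_antisym; [apply Hle|].
    assert (Hq'p : forall x, q' x <= p x)
      by (intros z; eapply Rle_trans; [apply Hle|apply Hqp]).
    assert (H := Hmin (exist _ q' (Logic.conj Hq' Hq'p)) (boolp.asboolT Hle)).
    apply boolp.asboolW in H. apply H.
Qed.

(** Take [f] minimal below [push p y]. Minimality makes [f] equal to its rescalings, hence
    homogeneous, and then to its pushes, hence odd; an odd subadditive functional is additive.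
    Starting from the push along [y] forces [f (- y) <= - p y]. *)
Theorem sublin_dominates_additive (p : list A -> R) (y : list A) :
  sublin p -> (forall t, INR t * p y <= p (rep t y)) ->
  exists f : list A -> R,
    (forall x z, f (x ++ z) = f x + f z) /\ (forall x, f (opp x) = - f x) /\
    (forall x, f x <= p x) /\ p y <= f y.
Proof.
  intros Hp Hy.
  destruct (sublin_minimal _ (push_sublin p y Hp Hy)) as [f [Hf [Hfp Hmin]]].
  assert (Hrep : forall t x, INR t * f x <= f (rep t x)).
  { intros [|t] x.
    - cbn. rewrite (sublin_nil f Hf). lra.
    - assert (Ht : (0 < S t)%nat) by lia.
      assert (Ht' := lt_INR _ _ Ht). change (INR 0) with 0 in Ht'.
      rewrite -(Hmin _ (sublin_rescale f (S t) Hf Ht)).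
      + right. field. lra.
      + intros z. apply (Rmult_le_reg_r (INR (S t))); [exact Ht'|].
        assert (H := sublin_rep_le f (S t) z Hf).
        unfold Rdiv. rewrite Rmult_assoc Rinv_l; lra. }
  assert (Hopp : forall x, f (opp x) = - f x).
  { intros x. apply Rle_antisym.
    - rewrite -(Hmin _ (push_sublin f x Hf (fun t => Hrep t x))).
      + apply push_opp; auto.
      + apply push_le; auto.
    - assert (H := sublin_opp_ge f x Hf). lra. }
  exists f. split; [|split; [exact Hopp|split]].
  - intros x z. apply Rle_antisym; [apply (sublin_add f Hf)|].
    assert (H := sublin_add f Hf (opp x) (opp z)).
    unfold opp in H. rewrite -map_app in H. fold (opp x) (opp z) (opp (x ++ z)) in H.
    rewrite !Hopp in H. lra.
  - intros x. eapply Rle_trans; [apply Hfp|]. now apply push_le.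
  - assert (H := push_opp p y Hp Hy). assert (H' := Hfp (opp y)).
    rewrite Hopp in H'. lra.
Qed.
End SublinearFunctionals.

(** * Conjugation, commutation and powers in a group *)

Section Groups.
Variable G : Group.
Implicit Types (x y z f g k : G) (n m : nat).

Lemma inv_unique x y : gmul x y = gone -> ginv x = y.
Proof.
  intros H. rewrite -[ginv x](gmul_1r G) -H (gmul_assoc G) (gmul_Vl G).
  apply (gmul_1l G).
Qed.

Lemma inv_inv x : ginv (ginv x) = x.
Proof. apply inv_unique, (gmul_Vl G). Qed.

Lemma inv_one : ginv gone = (gone : G).
Proof. apply inv_unique, (gmul_1l G). Qed.

Lemma mul_invK x y : gmul (gmul x y) (ginv y) = x.
Proof. now rewrite -(gmul_assoc G) (gmul_Vr G) (gmul_1r G). Qed.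

Lemma mul_Kinv x y : gmul (gmul x (ginv y)) y = x.
Proof. now rewrite -(gmul_assoc G) (gmul_Vl G) (gmul_1r G). Qed.

Lemma inv_mul x y : ginv (gmul x y) = gmul (ginv y) (ginv x).
Proof. apply inv_unique. now rewrite (gmul_assoc G) mul_invK (gmul_Vr G). Qed.

Lemma conj_one x : conj G gone x = x.
Proof. unfold conj. now rewrite inv_one (gmul_1l G) (gmul_1r G). Qed.

Lemma conj_conj f g x : conj G f (conj G g x) = conj G (gmul f g) x.
Proof. unfold conj. now rewrite inv_mul !(gmul_assoc G). Qed.

Lemma conj_mul g x y : conj G g (gmul x y) = gmul (conj G g x) (conj G g y).
Proof. unfold conj. now rewrite !(gmul_assoc G) mul_Kinv. Qed.

Lemma conj_id g : conj G g gone = gone.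
Proof. unfold conj. now rewrite (gmul_1r G) (gmul_Vr G). Qed.

Lemma conj_conj_conj f g x : conj G (conj G f g) (conj G f x) = conj G f (conj G g x).
Proof. rewrite !conj_conj. f_equal. unfold conj. apply mul_Kinv. Qed.

Lemma conj_commutes g x y : commutes G x y -> commutes G (conj G g x) (conj G g y).
Proof. unfold commutes. intros H. now rewrite -!conj_mul H. Qed.

Lemma commutes_one x : commutes G x gone.
Proof. unfold commutes. now rewrite (gmul_1l G) (gmul_1r G). Qed.

Lemma commutes_mul x y z : commutes G x y -> commutes G x z -> commutes G x (gmul y z).
Proof.
  unfold commutes. intros Hy Hz.
  now rewrite (gmul_assoc G) Hy -(gmul_assoc G) Hz (gmul_assoc G).
Qed.

Lemma commutes_pow x y n : commutes G x y -> commutes G x (gpow G y n).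
Proof.
  intros H. induction n as [|n IH]; [apply commutes_one|now apply commutes_mul].
Qed.

Lemma pow_add x n m : gpow G x (n + m) = gmul (gpow G x n) (gpow G x m).
Proof.
  induction n as [|n IH]; cbn; [now rewrite (gmul_1l G)|].
  now rewrite IH (gmul_assoc G).
Qed.

Lemma pow_mul x n m : gpow G x (n * m) = gpow G (gpow G x m) n.
Proof.
  induction n as [|n IH]; [reflexivity|]. cbn. now rewrite pow_add IH.
Qed.

Lemma pow_one n : gpow G gone n = gone.
Proof. induction n as [|n IH]; [reflexivity|]. cbn. now rewrite IH (gmul_1l G). Qed.

Lemma pow_conj g x n : gpow G (conj G g x) n = conj G g (gpow G x n).
Proof.
  induction n as [|n IH]; cbn; [now rewrite conj_id|]. now rewrite IH conj_mul.
Qed.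

Lemma pow_mul_commutes x y n : commutes G x y ->
  gpow G (gmul x y) n = gmul (gpow G x n) (gpow G y n).
Proof.
  intros H. induction n as [|n IH]; cbn; [now rewrite (gmul_1l G)|].
  assert (Hn : commutes G y (gpow G x n)) by (apply commutes_pow; now symmetry).
  rewrite IH !(gmul_assoc G). f_equal.
  now rewrite -(gmul_assoc G x y) Hn !(gmul_assoc G).
Qed.

Lemma pow_inv x n : gpow G (ginv x) n = ginv (gpow G x n).
Proof.
  symmetry. apply inv_unique. rewrite -pow_mul_commutes.
  - now rewrite (gmul_Vr G) pow_one.
  - unfold commutes. now rewrite (gmul_Vl G) (gmul_Vr G).
Qed.

(** * Commuting conjugates from far displacement *)

Section FarDisplacement.
Variable H : G -> Prop.
Hypothesis Hgen : c_generated G H.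

(** Write [f] as a product of conjugates of elements of [H] and displace [K] away from the
    conjugators that occur; the displaced [K] commutes with every factor. *)
Lemma far_disp_commutes (K : G -> Prop) k0 f : far_disp G H K k0 ->
  exists h, forall x, K x -> commutes G (conj G (conj G h k0) x) f.
Proof.
  intros Hfar. destruct (Hgen f) as [k [l [_ [Hl ->]]]].
  destruct (Hfar (map fst l)) as [h Hh]. exists h. intros x Kx.
  assert (Hin : forall p, In p l ->
            commutes G (conj G (conj G h k0) x) (conj G (fst p) (snd p))).
  { intros p Hp. apply Hh; [exact Kx|].
    exists (fst p), (snd p). split; [now apply in_map|]. split; auto. }
  clear Hl Hh. induction l as [|[g b] l IH]; [apply commutes_one|].
  cbn. apply commutes_mul; [apply (Hin (g, b)); now left|].
  apply IH. intros p Hp. apply Hin. now right.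
Qed.

(** Displace [H] from [c^-1 f c] and conjugate back by [c]. The displacing element stays a conjugate
    of [k0], so its norm is [nu k0] for all [f], [c] and [a]. *)
Lemma far_disp_conj_commutes k0 f c a : far_disp G H H k0 -> H a ->
  exists h, commutes G f (conj G (conj G h k0) (conj G c a)).
Proof.
  intros Hfar Ha.
  destruct (far_disp_commutes H k0 (conj G (ginv c) f) Hfar) as [h Hh].
  exists (gmul c h). assert (Hc := conj_commutes c _ _ (Hh a Ha)).
  rewrite -conj_conj_conj (conj_conj c h) (conj_conj c (ginv c)) (gmul_Vr G) conj_one in Hc.
  now symmetry.
Qed.

(** The conjugates of [H] containing the factors of [g] are displaced together. The norm of [k] is
    left uncontrolled: it only enters errors that are constant in the exponent. *)
Lemma FM_commuting_conjugate f g :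
  (forall hs, exists k0, far_disp G H (union_conjs G H hs) k0) ->
  exists k, commutes G f (conj G k g).
Proof.
  intros HFM. destruct (Hgen g) as [m [l [_ [Hl ->]]]].
  destruct (HFM (map fst l)) as [k0 Hk0].
  destruct (far_disp_commutes _ k0 f Hk0) as [h Hh].
  exists (conj G h k0).
  assert (Hin : forall p, In p l ->
            commutes G f (conj G (conj G h k0) (conj G (fst p) (snd p)))).
  { intros p Hp. symmetry. apply Hh. exists (fst p), (snd p).
    split; [now apply in_map|]. split; auto. }
  clear - Hin. induction l as [|[g b] l IH]; cbn.
  - rewrite conj_id. apply commutes_one.
  - rewrite conj_mul. apply commutes_mul; [apply (Hin (g, b)); now left|].
    apply IH. intros p Hp. apply Hin. now right.
Qed.
End FarDisplacement.

(** * The bi-invariant pseudo-distance of a pseudo-norm *)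

Section PseudoNorm.
Variable nu : G -> R.
Hypothesis Hnu : is_cinv_pseudo_norm nu.

Definition dist x y : R := nu (gmul x (ginv y)).

Lemma nu_ge0 x : 0 <= nu x. Proof. apply Hnu. Qed.
Lemma nu_one : nu gone = 0. Proof. apply Hnu. Qed.
Lemma nu_inv x : nu (ginv x) = nu x. Proof. symmetry. apply Hnu. Qed.
Lemma nu_mul x y : nu (gmul x y) <= nu x + nu y. Proof. apply Hnu. Qed.
Lemma nu_conj g x : nu (conj G g x) = nu x. Proof. apply Hnu. Qed.

Lemma nu_pow x n : nu (gpow G x n) <= INR n * nu x.
Proof.
  induction n as [|n IH].
  - cbn. rewrite nu_one. lra.
  - rewrite S_INR. cbn [gpow]. assert (H := nu_mul x (gpow G x n)). lra.
Qed.

Lemma dist_refl x : dist x x = 0.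
Proof. unfold dist. rewrite (gmul_Vr G). apply nu_one. Qed.

Lemma dist_sym x y : dist x y = dist y x.
Proof. unfold dist. rewrite -nu_inv. now rewrite inv_mul inv_inv. Qed.

Lemma dist_triangle x y z : dist x z <= dist x y + dist y z.
Proof.
  unfold dist. rewrite -(mul_Kinv x y) -(gmul_assoc G) mul_Kinv. apply nu_mul.
Qed.

(** Right invariance of [dist] is cancellation; left invariance is conjugation invariance of
    [nu]. *)
Lemma dist_mul x y x' y' : dist (gmul x y) (gmul x' y') <= dist x x' + dist y y'.
Proof.
  eapply Rle_trans; [apply (dist_triangle _ (gmul x y'))|].
  right. rewrite Rplus_comm. f_equal; unfold dist; rewrite inv_mul.
  - now rewrite (gmul_assoc G) mul_invK.
  - rewrite (gmul_assoc G) -(gmul_assoc G x). apply nu_conj.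
Qed.

Lemma dist_pow x y n : dist (gpow G x n) (gpow G y n) <= INR n * dist x y.
Proof.
  induction n as [|n IH].
  - cbn. rewrite dist_refl. lra.
  - rewrite S_INR. cbn [gpow].
    assert (H := dist_mul x (gpow G x n) y (gpow G y n)). lra.
Qed.

(** The quotient is [(x k x^-1) k^-1]. The bound is independent of [x], hence uniform over
    powers. *)
Lemma dist_conj k x : dist x (conj G k x) <= 2 * nu k.
Proof.
  unfold dist, conj. rewrite !inv_mul inv_inv !(gmul_assoc G).
  eapply Rle_trans; [apply nu_mul|]. rewrite nu_inv.
  assert (H := nu_conj x k). unfold conj in H. rewrite H. lra.
Qed.

Lemma nu_le_dist x y : nu x <= nu y + dist x y.
Proof.
  assert (H := nu_mul (gmul x (ginv y)) y). rewrite mul_Kinv in H.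
  unfold dist. lra.
Qed.

(** Replacing [g^n] by its conjugate, swapping, and replacing back costs [2 nu k] twice. *)
Lemma dist_mul_comm f g k n : commutes G f (conj G k g) ->
  dist (gmul (gpow G f n) (gpow G g n)) (gmul (gpow G g n) (gpow G f n)) <= 4 * nu k.
Proof.
  intros H.
  assert (Hc : gmul (gpow G f n) (conj G k (gpow G g n))
               = gmul (conj G k (gpow G g n)) (gpow G f n)).
  { rewrite -pow_conj. apply commutes_pow. symmetry. apply commutes_pow.
    now symmetry. }
  eapply Rle_trans;
    [apply (dist_triangle _ (gmul (conj G k (gpow G g n)) (gpow G f n)))|].
  assert (H1 := dist_mul (gpow G f n) (gpow G g n)
                  (gpow G f n) (conj G k (gpow G g n))).
  assert (H2 := dist_mul (conj G k (gpow G g n)) (gpow G f n)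
                  (gpow G g n) (gpow G f n)).
  rewrite dist_refl in H1. rewrite dist_refl in H2.
  rewrite Hc in H1. assert (H3 := dist_conj k (gpow G g n)).
  rewrite (dist_sym (conj _ _ _)) in H2. lra.
Qed.

(* Replacing [g] by its conjugate [conj k g] commuting with [f] costs [2 nu k]
   in each of the [n] factors [gmul f g], and [2 nu k] in [g^n]. *)
Lemma dist_pow_mul f g k n : commutes G f (conj G k g) ->
  dist (gpow G (gmul f g) n) (gmul (gpow G f n) (gpow G g n))
    <= INR n * (2 * nu k) + 2 * nu k.
Proof.
  intros H.
  eapply Rle_trans; [apply (dist_triangle _ (gpow G (gmul f (conj G k g)) n))|].
  apply Rplus_le_compat.
  - eapply Rle_trans; [apply dist_pow|]. apply Rmult_le_compat_l; [apply pos_INR|].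
    eapply Rle_trans; [apply dist_mul|]. rewrite dist_refl.
    assert (H' := dist_conj k g). lra.
  - rewrite (pow_mul_commutes _ _ n H) pow_conj.
    eapply Rle_trans; [apply dist_mul|]. rewrite dist_refl dist_sym.
    assert (H' := dist_conj k (gpow G g n)). lra.
Qed.

(** * Growth rates of formal sums *)

Fixpoint pow_prod (n : nat) (x : list G) : G :=
  match x with nil => gone | a :: x => gmul (gpow G a n) (pow_prod n x) end.

Lemma pow_prod_app n (x y : list G) :
  pow_prod n (x ++ y) = gmul (pow_prod n x) (pow_prod n y).
Proof.
  induction x as [|a x IH]; cbn; [now rewrite (gmul_1l G)|].
  now rewrite IH (gmul_assoc G).
Qed.

Lemma pow_prod_rep1 n m f : pow_prod n (rep G m (f :: nil)) = gpow G f (m * n).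
Proof.
  induction m as [|m IH]; [reflexivity|]. cbn. rewrite pow_add -IH. reflexivity.
Qed.

Lemma pow_prod_opp n (x : list G) :
  pow_prod n (rev (opp G ginv x)) = ginv (pow_prod n x).
Proof.
  induction x as [|a x IH]; cbn; [now rewrite inv_one|].
  rewrite pow_prod_app. unfold opp in IH. rewrite IH. cbn.
  now rewrite (gmul_1r G) pow_inv inv_mul.
Qed.

(** The infimum of these [c] is the limsup of [nu (pow_prod n x) / n]; in this form bounded errors
    disappear into [b]. *)
Definition grows (x : list G) (c : R) : Prop :=
  exists b, forall n, nu (pow_prod n x) <= INR n * c + b.

Definition growth (x : list G) : R := Inf (grows x).

Lemma grows_ge0 (x : list G) c : grows x c -> 0 <= c.
Proof.
  intros [b Hb]. apply Rnot_lt_le. intros Hc.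
  (* [N] is so large that [N c + b < 0]. *)
  destruct (archimed_cor1 (- c / (Rabs b + 1))) as [N [HN HN0]].
  - apply Rdiv_lt_0_compat; [lra|]. assert (H := Rabs_pos b). lra.
  - assert (HN1 := lt_INR _ _ HN0). change (INR 0) with 0 in HN1.
    specialize (Hb N). assert (H0 := nu_ge0 (pow_prod N x)).
    assert (H1 := Rabs_pos b). assert (H2 := Rle_abs b).
    apply (Rmult_lt_compat_r (INR N * (Rabs b + 1))) in HN;
      [|apply Rmult_lt_0_compat; lra].
    field_simplify in HN; lra.
Qed.

Lemma grows_nu (x : list G) : exists c, grows x c.
Proof.
  induction x as [|a x [c [b Hb]]].
  - exists 0, 0. intros n. cbn. rewrite nu_one. lra.
  - exists (nu a + c), b. intros n. cbn.
    assert (H := nu_mul (gpow G a n) (pow_prod n x)).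
    assert (H' := nu_pow a n). specialize (Hb n). lra.
Qed.

Lemma growth_glb (x : list G) :
  (forall c, grows x c -> growth x <= c) /\
  (forall b, (forall c, grows x c -> b <= c) -> b <= growth x).
Proof.
  destruct (grows_nu x) as [c Hc]. unfold growth.
  apply (Inf_glb (grows x) 0 c Hc). apply grows_ge0.
Qed.

Lemma growth_ge0 (x : list G) : 0 <= growth x.
Proof. apply growth_glb. apply grows_ge0. Qed.

Definition close (x y : list G) : Prop :=
  exists C, forall n, dist (pow_prod n x) (pow_prod n y) <= C.

Lemma growth_close (x y : list G) : close x y -> growth x <= growth y.
Proof.
  intros [C HC]. apply (proj2 (growth_glb y)). intros c [b Hb].
  apply growth_glb. exists (b + C). intros n.
  assert (H := nu_le_dist (pow_prod n x) (pow_prod n y)).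
  specialize (Hb n). specialize (HC n). lra.
Qed.

Lemma growth_ext (x y : list G) :
  (forall n, pow_prod n x = pow_prod n y) -> growth x = growth y.
Proof.
  intros H. apply Rle_antisym; apply growth_close; exists 0; intros n;
    rewrite H dist_refl; lra.
Qed.

Lemma growth_zero (x : list G) : close x nil -> growth x = 0.
Proof.
  intros [C HC]. apply Rle_antisym; [|apply growth_ge0].
  apply growth_glb. exists C. intros n. specialize (HC n). unfold dist in HC.
  cbn in HC. rewrite inv_one (gmul_1r G) in HC. lra.
Qed.

(** Each adjacent transposition costs a constant independent of [n], by [dist_mul_comm]. *)
Lemma close_perm : (forall f g, exists k, commutes G f (conj G k g)) ->
  forall x y : list G, Permutation x y -> close x y.
Proof.
  intros Hcomm x y Hxy. induction Hxy as [|a x y _ [C HC]|a b x|x y z _ [C HC] _ [C' HC']].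
  - exists 0. intros n. rewrite dist_refl. lra.
  - exists C. intros n. cbn. eapply Rle_trans; [apply dist_mul|].
    rewrite dist_refl. specialize (HC n). lra.
  - destruct (Hcomm b a) as [k Hk]. exists (4 * nu k). intros n. cbn.
    rewrite !(gmul_assoc G). eapply Rle_trans; [apply dist_mul|].
    rewrite dist_refl. assert (H := dist_mul_comm b a k n Hk). lra.
  - exists (C + C'). intros n. specialize (HC n). specialize (HC' n).
    assert (H := dist_triangle (pow_prod n x) (pow_prod n y) (pow_prod n z)). lra.
Qed.

Lemma growth_sublin : (forall f g, exists k, commutes G f (conj G k g)) ->
  sublin G ginv growth.
Proof.
  intros Hcomm.
  assert (Hperm : forall x y : list G, Permutation x y -> growth x = growth y).
  { intros x y H. apply Rle_antisym; apply growth_close, close_perm; auto.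
    now symmetry. }
  split.
  - intros x y.
    assert (H : forall c d, grows x c -> grows y d -> growth (x ++ y) <= c + d).
    { intros c d [b Hb] [b' Hb']. apply growth_glb. exists (b + b'). intros n.
      rewrite pow_prod_app. specialize (Hb n). specialize (Hb' n).
      assert (H := nu_mul (pow_prod n x) (pow_prod n y)). lra. }
    cut (growth (x ++ y) - growth x <= growth y); [lra|].
    apply (proj2 (growth_glb y)). intros d Hd.
    cut (growth (x ++ y) - d <= growth x); [lra|].
    apply (proj2 (growth_glb x)). intros c Hc. specialize (H c d Hc Hd). lra.
  - exact Hperm.
  (* In reversed order the inverse powers cancel those of [z] exactly. *)
  - intros z x. rewrite (Hperm _ (z ++ rev (opp G ginv z) ++ x)).
    + apply growth_ext. intros n. rewrite !pow_prod_app pow_prod_opp.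
      now rewrite (gmul_assoc G) (gmul_Vr G) (gmul_1l G).
    + apply Permutation_app_head, Permutation_app_tail, Permutation_rev.
  - apply growth_zero. exists 0. intros n. rewrite dist_refl. lra.
Qed.

(** This is the hypothesis of the Hahn-Banach theorem at [g]. A bound on the powers [g^(m n)]
    extends to all [g^N] by division with remainder, the remainder costing at most [m nu g]. *)
Lemma growth_rep1 m g :
  INR m * growth (g :: nil) <= growth (rep G m (g :: nil)).
Proof.
  apply (proj2 (growth_glb _)). intros c Hc. assert (Hc0 := grows_ge0 _ _ Hc).
  destruct Hc as [b Hb]. destruct m as [|m]; [simpl; lra|].
  assert (Hm := lt_0_INR (S m) (Nat.lt_0_succ m)).
  apply (Rmult_le_reg_r (/ INR (S m))); [now apply Rinv_0_lt_compat|].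
  replace (INR (S m) * growth (g :: nil) * / INR (S m)) with (growth (g :: nil))
    by (field; lra).
  apply growth_glb. exists (b + INR (S m) * nu g). intros N.
  rewrite (Nat.div_mod_eq N (S m)).
  set (n := (N / S m)%nat). set (r := (N mod S m)%nat).
  assert (Hr : (r < S m)%nat) by (apply Nat.mod_upper_bound; lia).
  apply lt_INR in Hr. specialize (Hb n). rewrite pow_prod_rep1 in Hb.
  cbn [pow_prod]. rewrite (gmul_1r G) pow_add plus_INR mult_INR.
  assert (H := nu_mul (gpow G g (S m * n)) (gpow G g r)).
  assert (H1 := nu_pow g r).
  assert (H2 : INR r * nu g <= INR (S m) * nu g)
    by (apply Rmult_le_compat_r; [apply nu_ge0|lra]).
  assert (H3 : 0 <= INR r * (c * / INR (S m))).
  { apply Rmult_le_pos; [apply pos_INR|]. apply Rmult_le_pos; [exact Hc0|].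
    now apply Rlt_le, Rinv_0_lt_compat. }
  replace ((INR (S m) * INR n + INR r) * (c * / INR (S m)))
    with (INR n * c + INR r * (c * / INR (S m))) by (field; lra).
  lra.
Qed.

Lemma stab_le_growth g : stab nu g <= growth (g :: nil).
Proof.
  apply (proj2 (growth_glb _)). intros c Hc. assert (Hc0 := grows_ge0 _ _ Hc).
  destruct Hc as [b Hb]. unfold stab.
  assert (Hlim : is_lim_seq (fun n => c + b * / INR n) c).
  { replace (Finite c) with (Finite (c + b * 0)) by (f_equal; lra).
    apply is_lim_seq_plus'; [apply is_lim_seq_const|].
    apply is_lim_seq_scal_l with (lu := Finite 0).
    apply (is_lim_seq_inv _ _ is_lim_seq_INR). discriminate. }
  assert (H : Rbar_le (Lim_seq (fun n => nu (gpow G g n) / INR n)) (Finite c)).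
  { rewrite -(is_lim_seq_unique _ _ Hlim). apply Lim_seq_le_loc.
    exists 1%nat. intros n Hn. assert (Hn' := lt_0_INR n Hn).
    specialize (Hb n). cbn in Hb. rewrite (gmul_1r G) in Hb.
    apply (Rmult_le_reg_r (INR n)); [exact Hn'|]. field_simplify; lra. }
  (* At [m_infty] the default value of [real] is 0, which is at most [c]. *)
  destruct (Lim_seq _); simpl in *; [exact H|contradiction|exact Hc0].
Qed.

(** * Quasimorphism bounds and the case of zero defect *)

Section Quasimorphism.
Variable phi : G -> R.

Lemma frag_norm_Inf (H : G -> Prop) f : c_generated G H ->
  frag_norm H f = Finite (Inf (fun r => exists k : nat, frag_le G H f k /\ r = INR k)) /\
  forall b, (forall k : nat, frag_le G H f k -> b <= INR k) ->
    b <= Inf (fun r => exists k : nat, frag_le G H f k /\ r = INR k).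
Proof.
  intros Hgen. destruct (Hgen f) as [k Hk].
  assert (Hm : forall s, (exists k : nat, frag_le G H f k /\ s = INR k) -> 0 <= s)
    by (intros s [i [_ ->]]; apply pos_INR).
  assert (H0 : exists i, frag_le G H f i /\ INR k = INR i) by now exists k.
  split; [exact (Glb_Rbar_Inf _ 0 (INR k) H0 Hm)|].
  intros b Hb. apply (proj2 (Inf_glb _ 0 (INR k) H0 Hm)). intros s [i [Hi ->]].
  now apply Hb.
Qed.

(** Lets bounds be checked on explicit fragmentations; dividing by [C] passes to the infimum over
    their lengths. *)
Lemma qm_bound_frag (H : G -> Prop) C : c_generated G H -> 0 <= C ->
  (forall f g (k : nat), frag_le G H f k \/ frag_le G H g k ->
     Rabs (phi (gmul f g) - phi f - phi g) <= C * INR k) ->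
  qm_bound G H phi C.
Proof.
  intros Hgen HC Hb f g.
  set (d := Rabs _).
  destruct (frag_norm_Inf H f Hgen) as [-> Hf].
  destruct (frag_norm_Inf H g Hgen) as [-> Hg].
  set (rf := Inf _). set (rg := Inf _). cbn.
  change (d <= C * Rmin rf rg).
  destruct (Rle_lt_or_eq_dec 0 C HC) as [HC0|<-].
  - apply (Rmult_le_reg_l (/ C)); [now apply Rinv_0_lt_compat|].
    rewrite -Rmult_assoc Rinv_l ?Rmult_1_l; [|lra].
    apply Rmin_glb; [apply Hf|apply Hg]; intros k Hk;
      apply (Rmult_le_reg_l C); trivial;
      (rewrite -Rmult_assoc Rinv_r ?Rmult_1_l; [|lra]); apply Hb; auto.
  (* For [C = 0] any single fragmentation gives the bound 0. *)
  - destruct (Hgen f) as [k Hk]. rewrite Rmult_0_l.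
    rewrite -(Rmult_0_l (INR k)). apply Hb. now left.
Qed.

(** Admissible constants come arbitrarily close to 0. This settles the case where the quotient by
    the defect degenerates. *)
Lemma quasimorphism_defect0 (H : G -> Prop) : c_generated G H ->
  H_quasimorphism H phi -> defect H phi <= 0 ->
  forall f g, phi (gmul f g) = phi f + phi g.
Proof.
  intros Hgen [C0 HC0] HD f g.
  destruct (frag_norm_Inf H f Hgen) as [Hf _].
  destruct (frag_norm_Inf H g Hgen) as [Hg _].
  set (rf := Inf _) in Hf. set (rg := Inf _) in Hg.
  set (d := Rabs (phi (gmul f g) - phi f - phi g)).
  assert (Hr : forall C, 0 < C -> qm_bound G H phi C -> d <= C * Rmin rf rg).
  { intros C _ HC. specialize (HC f g). rewrite Hf Hg in HC. exact HC. }
  destruct (Inf_glb (fun C => 0 < C /\ qm_bound G H phi C) 0 C0) as [_ Hinf].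
  { exact HC0. }
  { intros s [Hs _]. lra. }
  change (Inf (fun C => 0 < C /\ qm_bound G H phi C)) with (defect H phi) in Hinf.
  assert (Hd : d <= 0).
  { apply Rnot_lt_le. intros Hd.
    assert (H0 := Hr C0 (proj1 HC0) (proj2 HC0)).
    (* Positivity allows dividing by the minimum, making [d / Rmin rf rg] a lower bound for
       admissible constants. *)
    assert (Hmin : 0 < Rmin rf rg).
    { apply Rnot_le_lt. intros Hm. destruct HC0 as [HC0 _].
      apply (Rmult_le_compat_l C0) in Hm; lra. }
    assert (Hpos : d / Rmin rf rg <= defect H phi).
    { apply Hinf. intros C [HC1 HC2]. specialize (Hr C HC1 HC2).
      apply (Rmult_le_reg_r (Rmin rf rg)); [exact Hmin|].
      unfold Rdiv. rewrite Rmult_assoc Rinv_l; lra. }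
    assert (0 < d / Rmin rf rg) by now apply Rdiv_lt_0_compat.
    lra. }
  assert (H0 := Rabs_pos (phi (gmul f g) - phi f - phi g)). fold d in H0.
  assert (Hd0 : d = 0) by lra. unfold d in Hd0.
  destruct (Req_dec (phi (gmul f g) - phi f - phi g) 0) as [E|E]; [lra|].
  now apply Rabs_no_R0 in E.
Qed.

Lemma additive_commutator_subgroup g :
  (forall x y, phi (gmul x y) = phi x + phi y) -> in_commutator_subgroup g ->
  phi g = 0.
Proof.
  intros Hadd [l ->].
  assert (H1 : phi gone = 0).
  { assert (H := Hadd gone gone). rewrite (gmul_1l G) in H. lra. }
  assert (Hinv : forall x, phi x + phi (ginv x) = 0)
    by (intros x; now rewrite -Hadd (gmul_Vr G)).
  induction l as [|[a b] l IH]; cbn; [exact H1|].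
  unfold commutator. rewrite !Hadd IH. specialize (Hinv a) as Ha.
  specialize (Hinv b). lra.
Qed.
End Quasimorphism.

(** * From an additive functional to a homogeneous quasimorphism *)

Lemma grows_defect f g k : commutes G f (conj G k g) ->
  grows (gmul f g :: ginv g :: ginv f :: nil) (2 * nu k).
Proof.
  intros H. exists (2 * nu k). intros n. cbn.
  (* The product is [(f g)^n (f^n g^n)^-1], so its norm is a distance. *)
  rewrite (gmul_1r G) !pow_inv -inv_mul. now apply dist_pow_mul.
Qed.

(** [f g] is the conjugate of [g f] by [f], and so are their powers. This yields
    [phi (f g) = phi (g f)]. *)
Lemma close_conj f g : close (gmul f g :: ginv (gmul g f) :: nil) nil.
Proof.
  exists (2 * nu f). intros n. cbn. unfold dist.
  rewrite inv_one !(gmul_1r G) pow_inv.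
  replace (gmul f g) with (conj G f (gmul g f)).
  - rewrite pow_conj -/(dist _ _) dist_sym. apply dist_conj.
  - unfold conj. now rewrite (gmul_assoc G) mul_invK.
Qed.

(** [phi] is the additive functional on one-letter sums. It is chosen before [H], so one function
    serves all [H]. *)
Lemma exists_quasimorphism g :
  (forall x y, exists k, commutes G x (conj G k y)) ->
  exists phi : G -> R,
    homogeneous phi /\ stab nu g <= phi g /\ 0 <= phi g /\
    forall (H : G -> Prop) k0 C, c_generated G H -> far_disp G H H k0 ->
      4 * nu k0 <= C -> qm_bound G H phi C.
Proof.
  intros Hcomm. assert (Hsub := growth_sublin Hcomm).
  destruct (sublin_dominates_additive G ginv growth (g :: nil) Hsub
              (fun t => growth_rep1 t g)) as [F [Hadd [Hopp [Hle Hg]]]].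
  set (phi := fun x => F (x :: nil)).
  assert (Hnil : F nil = 0) by (assert (H := Hadd nil nil); cbn in H; lra).
  assert (Hcons : forall a (x : list G), F (a :: x) = phi a + F x)
    by (intros a x; apply (Hadd (a :: nil))).
  assert (Hinv : forall x, phi (ginv x) = - phi x)
    by (intros x; apply (Hopp (x :: nil))).
  (* [F] sees only the sequence of power products, since the difference of two such sums has growth
     0. *)
  assert (Hzero : forall x y : list G, (forall n, pow_prod n x = pow_prod n y) -> F x = F y).
  { assert (H : forall x y : list G, (forall n, pow_prod n x = pow_prod n y) -> F x <= F y).
    { intros x y Hxy. assert (Hd := Hle (x ++ opp G ginv y)).
      rewrite Hadd Hopp (sublin_perm _ _ _ Hsub _ (x ++ rev (opp G ginv y))) in Hd.
      - rewrite growth_zero in Hd; [lra|]. exists 0. intros n.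
        rewrite pow_prod_app pow_prod_opp Hxy (gmul_Vr G) dist_refl. lra.
      - apply Permutation_app_head, Permutation_rev. }
    intros x y Hxy. apply Rle_antisym; apply H; auto. }
  assert (Hpow : forall x m, phi (gpow G x m) = INR m * phi x).
  { intros x m. unfold phi at 1.
    rewrite (Hzero _ (rep G m (x :: nil))).
    - induction m as [|m IH]; [cbn; rewrite Hnil; lra|].
      rewrite S_INR. change (rep G (S m) (x :: nil)) with (x :: rep G m (x :: nil)).
      rewrite Hcons IH. lra.
    - intros n. cbn. rewrite (gmul_1r G) pow_prod_rep1 -pow_mul.
      now rewrite Nat.mul_comm. }
  exists phi. split; [|split; [|split]].
  - intros f [|m|m]; cbn [gpowZ].
    + exact (Hpow f 0%nat).
    + rewrite Hpow INR_IPR. reflexivity.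
    + rewrite Hinv Hpow INR_IPR.
      symmetry. apply Ropp_mult_distr_l_reverse.
  - eapply Rle_trans; [apply stab_le_growth|exact Hg].
  - eapply Rle_trans; [apply growth_ge0|exact Hg].
  - intros H k0 C Hgen Hfar HC.
    assert (Hk0 := nu_ge0 k0).
    assert (H1 : forall f c a, H a ->
        Rabs (phi (gmul f (conj G c a)) - phi f - phi (conj G c a)) <= 2 * nu k0).
    { intros f c a Ha.
      destruct (far_disp_conj_commutes H Hgen k0 f c a Hfar Ha) as [h Hh].
      apply grows_defect in Hh. rewrite nu_conj in Hh.
      set (b := conj G c a) in Hh |- *.
      set (z := gmul f b :: ginv b :: ginv f :: nil) in Hh.
      assert (Hz : F z = phi (gmul f b) - phi f - phi b)
        by (unfold z; rewrite !Hcons !Hinv Hnil; lra).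
      rewrite -Hz. assert (Hz1 := proj1 (growth_glb z) _ Hh).
      (* Inverses have equal norm, so [- z] grows no faster; this bounds [F z] from below. *)
      assert (Hz2 : growth (opp G ginv z) <= 2 * nu k0).
      { rewrite (sublin_perm _ _ _ Hsub _ _ (Permutation_rev _)).
        apply growth_glb. destruct Hh as [B HB]. exists B. intros n.
        rewrite pow_prod_opp nu_inv. apply HB. }
      assert (Hz3 := Hle z). assert (Hz4 := Hle (opp G ginv z)).
      rewrite Hopp in Hz4. apply Rabs_le. lra. }
    (* Conjugates of elements of [H] are split off one at a time, each with error [2 nu k0]. *)
    assert (H2 : forall l f, (forall p, In p l -> H (snd p)) ->
        Rabs (phi (gmul f (prod_conj G l)) - phi f
              - F (map (fun p => conj G (fst p) (snd p)) l)) <= INR (length l) * (2 * nu k0)).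
    { induction l as [|[c a] l IH]; intros f Hl.
      - cbn. rewrite (gmul_1r G) Hnil. rewrite Rabs_pos_eq; lra.
      - cbn [prod_conj map length fst snd]. rewrite S_INR (gmul_assoc G) Hcons.
        specialize (IH (gmul f (conj G c a)) (fun p Hp => Hl p (or_intror Hp))).
        specialize (H1 f c a (Hl (c, a) (or_introl eq_refl))).
        apply Rabs_le_between in IH. apply Rabs_le_between in H1. apply Rabs_le. lra. }
    assert (H3 : forall f b (k : nat), frag_le G H b k ->
        Rabs (phi (gmul f b) - phi f - phi b) <= C * INR k).
    { intros f b k [l [<- [Hl ->]]].
      (* Comparing [f b] and [b] with the same sum over the factors of [b] doubles the error per
         factor to [4 nu k0]. *)
      assert (Hf := H2 l f Hl). assert (H0 := H2 l gone Hl).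
      rewrite (gmul_1l G) in H0. assert (Hone := Hpow gone 0%nat). cbn in Hone.
      assert (Hk := pos_INR (length l)).
      apply (Rmult_le_compat_r (INR (length l))) in HC; [|exact Hk].
      apply Rabs_le_between in Hf. apply Rabs_le_between in H0. apply Rabs_le. lra. }
    (* Symmetry carries the bound from fragmentations of the second argument to those of the
       first. *)
    assert (Hsym : forall f b, phi (gmul f b) = phi (gmul b f)).
    { assert (H0 : forall f b, phi (gmul f b) <= phi (gmul b f)).
      { intros f b. assert (Hz := Hle (gmul f b :: ginv (gmul b f) :: nil)).
        rewrite !Hcons Hinv Hnil (growth_zero _ (close_conj f b)) in Hz. lra. }
      intros f b. now apply Rle_antisym. }
    apply qm_bound_frag; [exact Hgen|lra|].
    intros f b k [Hk|Hk]; [|now apply H3].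
    rewrite Hsym. replace (phi (gmul b f) - phi f - phi b)
      with (phi (gmul b f) - phi b - phi f) by ring. now apply H3.
Qed.
End PseudoNorm.

(** * Deduction of both statements *)

Lemma FM_far_disp (H : G -> Prop) : FM_pair H -> exists k0, far_disp G H H k0.
Proof.
  (* With the single conjugator [gone] the union of conjugates is [H] itself. *)
  intros [_ [_ HFM]]. destruct (HFM (gone :: nil)) as [k0 Hk0].
  exists k0. intros gs. destruct (Hk0 gs) as [h Hh]. exists h. intros x y Hx.
  apply Hh. exists gone, x. split; [now left|]. split; [exact Hx|].
  symmetry. apply conj_one.
Qed.
End Groups.

Theorem theorem1p12 (G : Group) (nu : G -> R)
  (HFM : satisfies_FM G) (Hnu : is_cinv_pseudo_norm nu) :
  (forall g : G, 0 < stab nu g ->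
     exists phi : G -> R,
       (forall H : G -> Prop, FM_pair H -> homogeneous phi /\ H_quasimorphism H phi)
       /\ 0 < phi g)
  /\
  (forall (g : G) (H : G -> Prop), in_commutator_subgroup g -> FM_pair H ->
     Rbar_le (Finite (stab nu g))
       (Rbar_mult (Finite 8)
          (Lub_Rbar (fun r => exists phi : G -> R,
               homogeneous phi /\ H_quasimorphism H phi /\
               r = (if Rlt_dec 0 (defect H phi)
                    then phi g * far_energy H nu H / defect H phi
                    else 0))))).
Proof.
  assert (Hcomm : forall x y : G, exists k, commutes G x (conj G k y)).
  { destruct HFM as [H [_ [Hgen Hfar]]]. intros x y.
    now apply (FM_commuting_conjugate G H Hgen). }
  assert (Hqm : forall H (phi : G -> R), FM_pair H ->
    (forall k0 C, c_generated G H -> far_disp G H H k0 -> 4 * nu k0 <= C ->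
       qm_bound G H phi C) -> H_quasimorphism H phi).
  { intros H phi HH Hb. destruct (FM_far_disp G H HH) as [k0 Hk0].
    destruct HH as [_ [Hgen _]]. assert (Hk := nu_ge0 G nu Hnu k0).
    (* The 1 keeps the constant positive when [nu k0] vanishes. *)
    exists (4 * nu k0 + 1). split; [lra|]. apply (Hb k0); trivial. lra. }
  split; intros g.
  - intros Hg. destruct (exists_quasimorphism G nu Hnu g Hcomm)
      as [phi [Hhom [Hstab [_ Hb]]]].
    exists phi. split; [|lra]. intros H HH. split; [exact Hhom|].
    apply (Hqm H phi HH). intros k0 C. apply Hb.
  - intros H Hg HH. destruct (exists_quasimorphism G nu Hnu g Hcomm)
      as [phi [Hhom [Hstab [Hpos Hb]]]].
    specialize (Hb H). assert (HQ := Hqm H phi HH Hb).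
    destruct (FM_far_disp G H HH) as [k0 Hk0]. destruct HH as [_ [Hgen _]].
    set (E := far_energy H nu H). set (D := defect H phi).
    assert (HDE : D <= 4 * E).
    { cut (D / 4 <= E); [lra|].
      destruct (Inf_glb (fun e => exists h0, far_disp G H H h0 /\ e = nu h0)
                  0 (nu k0)) as [_ HE].
      { now exists k0. }
      { intros s [h [_ ->]]. apply (nu_ge0 G nu Hnu). }
      apply HE. intros s [h [Hh ->]].
      destruct (Inf_glb (fun C => 0 < C /\ qm_bound G H phi C) 0
                  (4 * nu k0 + 1)) as [HD _].
      { assert (Hk := nu_ge0 G nu Hnu k0). split; [lra|].
        apply (Hb k0); trivial. lra. }
      { intros s [Hs _]. lra. }
      (* Again a positive slack, since [4 nu h] may be 0. *)
      apply le_epsilon. intros eps Heps.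
      cut (D <= 4 * nu h + 4 * eps); [lra|].
      apply HD. assert (Hk := nu_ge0 G nu Hnu h). split; [lra|].
      apply (Hb h); trivial. lra. }
    set (S := fun r : R => _).
    assert (HS : exists r, S r /\ stab nu g <= 8 * r).
    { eexists. split; [exists phi; split; [exact Hhom|split; [exact HQ|reflexivity]]|].
      fold E D. destruct (Rlt_dec 0 D) as [HD|HD].
      - assert (HE : 0 <= phi g * E) by (apply Rmult_le_pos; lra).
        apply (Rmult_le_reg_r D); [exact HD|].
        replace (8 * (phi g * E / D) * D) with (8 * phi g * E) by (field; lra).
        apply (Rmult_le_compat_l (phi g)) in HDE; [|exact Hpos].
        apply (Rmult_le_compat_r D) in Hstab; [|lra].
        lra.
      (* With zero defect [phi] is a homomorphism to the reals, so it vanishes on [g] and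
         [stab nu g <= 0], matching the default 0 of the quotient. *)
      - assert (Hadd := quasimorphism_defect0 G phi H Hgen HQ (Rnot_lt_le _ _ HD)).
        rewrite (additive_commutator_subgroup G phi g Hadd Hg) in Hstab. lra. }
    destruct HS as [r [Hr Hle]].
    assert (Hub := proj1 (Lub_Rbar_correct S) r Hr).
    (* The supremum may be infinite; then [8 * p_infty] is resolved by the sign of 8. *)
    destruct (Lub_Rbar S) as [s| |]; [|cbn|contradiction].
    + simpl in Hub |- *. lra.
    + destruct (Rle_dec 0 8) as [H8|H8]; [|lra].
      destruct (Rle_lt_or_eq_dec 0 8 H8) as [H8'|H8']; [exact I|lra].
Qed.
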